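(* Let $\Omega=B(0,1)\subset\mathbb{R}^n$ and $\Omega_k=B\left(0,1-\frac1k\right)$. Let $H:\overline\Omega\times\mathbb{R}^n\to\mathbb{R}$ be continuous and assume: (1) there is $C_1>0$ with $H(x,p)\ge -C_1$ for all $(x,p)\in\overline\Omega\times\mathbb{R}^n$; (2) there is $C_2>0$ with $\sup_{x\in\overline\Omega}|H(x,0)|\le C_2$; (3) for each $R>0$ there is a constant $C_R$ such that $|H(x,p)-H(y,p)|\le C_R|x-y|$ and $|H(x,p)-H(x,q)|\le C_R|p-q|$ for all $x,y\in\overline\Omega$ and all $p,q\in\mathbb{R}^n$ with $|p|,|q|\le R$; (4) $\lim_{|p|\to\infty}\big(\inf_{x\in\overline\Omega}H(x,p)\big)=+\infty$. Let $u_k$ be the unique state-constraint viscosity solution of $u_k(x)+H(x,Du_k(x))=0$ in $\Omega_k$ and $u$ the unique state-constraint viscosity solution of $u(x)+H(x,Du(x))=0$ in $\Omega$. Then, for any $k\ge2$, $$0\le u_k(x)-u(x)\le\frac{C}{k}$$ for every $x\in\overline{B\left(0,1-\frac1k\right)}$, where $C$ is a constant depending only on $H$. Moreover, this rate is optimal.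
   Context: $k$ denotes a positive integer; $B(0,r)$ is the open ball of radius $r$ centered at $0$ in $\mathbb{R}^n$. BUC denotes bounded uniformly continuous functions. For an open set $U\subset\mathbb{R}^n$ and a continuous $H$: $v\in \mathrm{BUC}(U;\mathbb{R})$ is a viscosity subsolution of $v+H(x,Dv)=0$ in $U$ if for every $x\in U$ and $\varphi\in C^1(U)$ such that $v-\varphi$ has a local maximum over $U$ at $x$, $v(x)+H(x,D\varphi(x))\le 0$. $v\in \mathrm{BUC}(\overline U;\mathbb{R})$ is a viscosity supersolution on $\overline U$ if for every $x\in\overline U$ and $\varphi\in C^1(\overline U)$ such that $v-\varphi$ has a local minimum over $\overline U$ at $x$, $v(x)+H(x,D\varphi(x))\ge 0$. A state-constraint viscosity solution in $U$ is a function that is both a viscosity subsolution in $U$ and a viscosity supersolution on $\overline U$. Under the hypotheses of the claim, such solutions exist and are unique. *)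

(* Defs.v *)
From HB Require Import structures.
From mathcomp Require Import all_boot all_order all_algebra.
From mathcomp Require Import all_classical all_reals all_analysis.

Set Implicit Arguments.
Unset Strict Implicit.
Unset Printing Implicit Defensive.

Import Order.TTheory GRing.Theory Num.Theory.
Import numFieldNormedType.Exports.

Local Open Scope classical_set_scope.
Local Open Scope ring_scope.

(* R^n is 'rV[R]_n.  The library norm on this type is the sup norm, which
   induces the right topology and uniformity but not the Euclidean balls, hence
   the definition of enorm. *)
Definition enorm (R : realType) (n : nat) (x : 'rV[R]_n) : R :=
  Num.sqrt (\sum_(i < n) x ord0 i ^+ 2).

Definition eball0 (R : realType) (n : nat) (r : R) : set 'rV[R]_n :=
  [set x | enorm x < r].
Arguments eball0 {R} n r.

Definition grad (R : realType) (n : nat) (phi : 'rV[R]_n -> R) (x : 'rV[R]_n) :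
    'rV[R]_n :=
  \row_(i < n) 'D_('e_i) phi x.

(* For an open set A one may take V = A, so that this is C^1(A).  For the closure
   of a ball this is C^1 up to the boundary, in the sense of restrictions of
   functions that are C^1 in a neighbourhood. *)
Definition C1_on (R : realType) (n : nat) (A : set 'rV[R]_n)
    (phi : 'rV[R]_n -> R) : Prop :=
  exists V : set 'rV[R]_n,
    [/\ open V, A `<=` V &
        forall x, V x -> differentiable phi x /\ {for x, continuous (grad phi)}].

(* Functions on A are represented by total functions; only their values on A
   matter. *)
Definition BUC (R : realType) (n : nat) (A : set 'rV[R]_n)
    (v : 'rV[R]_n -> R) : Prop :=
  (exists M : R, forall x, A x -> `|v x| <= M) /\
  (forall e : R, 0 < e -> exists2 d : R, 0 < d &
     forall x y, A x -> A y -> enorm (x - y) < d -> `|v x - v y| < e).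

Definition local_max_over (R : realType) (n : nat) (A : set 'rV[R]_n)
    (f : 'rV[R]_n -> R) (x : 'rV[R]_n) : Prop :=
  \forall y \near within A (nbhs x), f y <= f x.

Definition local_min_over (R : realType) (n : nat) (A : set 'rV[R]_n)
    (f : 'rV[R]_n -> R) (x : 'rV[R]_n) : Prop :=
  \forall y \near within A (nbhs x), f x <= f y.

Definition viscosity_subsolution (R : realType) (n : nat)
    (H : 'rV[R]_n -> 'rV[R]_n -> R) (A : set 'rV[R]_n)
    (v : 'rV[R]_n -> R) : Prop :=
  BUC A v /\
  forall (x : 'rV[R]_n) (phi : 'rV[R]_n -> R),
    A x -> C1_on A phi -> local_max_over A (fun y => v y - phi y) x ->
    v x + H x (grad phi x) <= 0.

Definition viscosity_supersolution (R : realType) (n : nat)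
    (H : 'rV[R]_n -> 'rV[R]_n -> R) (A : set 'rV[R]_n)
    (v : 'rV[R]_n -> R) : Prop :=
  BUC A v /\
  forall (x : 'rV[R]_n) (phi : 'rV[R]_n -> R),
    A x -> C1_on A phi -> local_min_over A (fun y => v y - phi y) x ->
    0 <= v x + H x (grad phi x).

Definition state_constraint_solution (R : realType) (n : nat)
    (H : 'rV[R]_n -> 'rV[R]_n -> R) (U : set 'rV[R]_n)
    (v : 'rV[R]_n -> R) : Prop :=
  viscosity_subsolution H U v /\ viscosity_supersolution H (closure U) v.

(* H is a function on closure Omega x R^n, extended arbitrarily. *)
Record hamiltonian_assumptions (R : realType) (n : nat) (Omega : set 'rV[R]_n)
    (H : 'rV[R]_n -> 'rV[R]_n -> R) : Prop := {
  ham_continuous :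
    {within closure Omega `*` [set: 'rV[R]_n],
      continuous (fun z : 'rV[R]_n * 'rV[R]_n => H z.1 z.2)};
  ham_bounded_below :
    exists2 C1 : R, 0 < C1 & forall x p, closure Omega x -> - C1 <= H x p;
  ham_bounded_at_0 :
    exists2 C2 : R, 0 < C2 &
      (ereal_sup [set `|H x 0|%:E | x in closure Omega] <= C2%:E)%E;
  ham_locally_lipschitz :
    forall r : R, 0 < r -> exists C : R,
      forall x y p q, closure Omega x -> closure Omega y ->
        enorm p <= r -> enorm q <= r ->
        `|H x p - H y p| <= C * enorm (x - y) /\
        `|H x p - H x q| <= C * enorm (p - q);
  ham_coercive :
    forall M : R, \forall r \near +oo, forall p : 'rV[R]_n, r <= enorm p ->
      (M%:E <= ereal_inf [set (H x p)%:E | x in closure Omega])%E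
}.

(* Main.v *)
Require Import Defs.
From mathcomp Require Import all_boot all_order all_algebra.
From mathcomp Require Import all_classical all_reals all_analysis.
From mathcomp Require Import ring lra.
Import Order.TTheory GRing.Theory Num.Theory.
Import numFieldNormedType.Exports.
Local Open Scope classical_set_scope.
Local Open Scope ring_scope.

(* Write [B_s] for the ball of radius [s].  Let [v] be a subsolution in [B_r] and
   [w] a supersolution on the closure of [B_s], with [0 <= t <= 1] and [t * s < r].
   Maximize [v x - w y - N |x - t y|^2]: for large [N] the point [x] is close to
   [t y], hence interior to [B_r], while [y] may lie on the boundary of [B_s], where
   the state constraint still gives the supersolution inequality.  Comparing the two
   inequalities yields [v (t z) - w z <= C (1 - t)].  For [v := u], [w := u_k],
   [t = 1] this is the lower bound.  For [v := u_k], [w := u], letting [t] tend to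
   [1 - 1/k], together with the Lipschitz continuity of subsolutions of coercive
   equations, it is the upper bound.  All constants depend on [H] only because
   a supersolution is bounded below by [- sup |H x 0|], so coercivity bounds the
   gradients at which a solution is touched from above.

   For optimality, [- r^2 |x|^2] solves the state-constraint problem on every
   [B_r], [0 < r <= 1], for one and the same Hamiltonian. *)

(** * Euclidean geometry of row vectors *)

Definition dot (R : realType) (n : nat) (x y : 'rV[R]_n) : R :=
  \sum_(i < n) x ord0 i * y ord0 i.
Arguments dot {R n} x y.

Section Euclidean.
Context {R : realType} {n : nat}.
Implicit Types x y z : 'rV[R]_n.

Lemma dotC x y : dot x y = dot y x.
Proof. by apply: eq_bigr => i _; rewrite mulrC. Qed.

Lemma dotDl x y z : dot (x + y) z = dot x z + dot y z.
Proof. by rewrite -big_split; apply: eq_bigr => i _; rewrite mxE mulrDl. Qed.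

Lemma dotZl a x z : dot (a *: x) z = a * dot x z.
Proof. by rewrite mulr_sumr; apply: eq_bigr => i _; rewrite mxE mulrA. Qed.

Lemma dotDr x y z : dot z (x + y) = dot z x + dot z y.
Proof. by rewrite dotC dotDl !(dotC z). Qed.

Lemma dotZr a x z : dot z (a *: x) = a * dot z x.
Proof. by rewrite dotC dotZl dotC. Qed.

Lemma dotNl x z : dot (- x) z = - dot x z.
Proof. by rewrite -scaleN1r dotZl mulN1r. Qed.

Lemma dotNr x z : dot z (- x) = - dot z x.
Proof. by rewrite dotC dotNl dotC. Qed.

Lemma dotxx_ge0 x : 0 <= dot x x.
Proof. by apply: sumr_ge0 => i _; rewrite -expr2 sqr_ge0. Qed.

Lemma enormE x : enorm x = Num.sqrt (dot x x).
Proof. by congr Num.sqrt; apply: eq_bigr => i _; rewrite expr2. Qed.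

Lemma enorm_ge0 x : 0 <= enorm x.
Proof. exact: sqrtr_ge0. Qed.

Lemma sqr_enorm x : enorm x ^+ 2 = dot x x.
Proof. by rewrite enormE sqr_sqrtr ?dotxx_ge0. Qed.

Lemma enorm0 : enorm (0 : 'rV[R]_n) = 0.
Proof.
by rewrite enormE /dot big1 ?sqrtr0 // => i _; rewrite mxE mul0r.
Qed.

Lemma enorm_coord x i : `|x ord0 i| <= enorm x.
Proof.
rewrite -ler_sqr ?nnegrE ?enorm_ge0// sqr_enorm real_normK ?num_real//.
rewrite /dot (bigD1 i)//= -expr2 lerDl; apply: sumr_ge0 => j _.
by rewrite -expr2 sqr_ge0.
Qed.

Lemma enorm_eq0 x : enorm x = 0 -> x = 0.
Proof.
move=> x0; apply/rowP => i; rewrite mxE; apply/eqP; rewrite -normr_le0.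
by rewrite -x0 enorm_coord.
Qed.

Lemma enormZ a x : enorm (a *: x) = `|a| * enorm x.
Proof.
by rewrite !enormE dotZl dotZr mulrA -expr2 sqrtrM ?sqr_ge0// sqrtr_sqr.
Qed.

Lemma enormN x : enorm (- x) = enorm x.
Proof. by rewrite -scaleN1r enormZ normrN1 mul1r. Qed.

Lemma enormB x y : enorm (x - y) = enorm (y - x).
Proof. by rewrite -enormN opprB. Qed.

Lemma dot0r x : dot x 0 = 0.
Proof. by rewrite -(scale0r (0 : 'rV[R]_n)) dotZr mul0r. Qed.

(** Cauchy-Schwarz, from the nonnegative squared norm of [enorm y ^+ 2 *: x - dot x y *: y]. *)
Lemma dot_le_enorm x y : dot x y <= enorm x * enorm y.
Proof.
have [/enorm_eq0 ->|y0] := eqVneq (enorm y) 0; first by rewrite dot0r enorm0 mulr0.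
have y_gt0 : 0 < enorm y by rewrite lt_def y0 enorm_ge0.
have := dotxx_ge0 (enorm y ^+ 2 *: x - dot x y *: y).
rewrite !(dotDl, dotDr, dotZl, dotZr, dotNl, dotNr) (dotC y x) -!sqr_enorm.
rewrite [X in 0 <= X](_ : _ =
  enorm y ^+ 2 * ((enorm x * enorm y) ^+ 2 - dot x y ^+ 2)); last by ring.
rewrite pmulr_rge0 ?exprn_gt0// subr_ge0 => xy.
apply: le_trans (ler_norm _) _.
by rewrite -ler_sqr ?nnegrE ?mulr_ge0 ?enorm_ge0// real_normK ?num_real.
Qed.

Lemma normr_dot_le x y : `|dot x y| <= enorm x * enorm y.
Proof.
by rewrite ler_norml dot_le_enorm andbT lerNl -dotNl -(enormN x) dot_le_enorm.
Qed.

Lemma sqr_enormD x y :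
  enorm (x + y) ^+ 2 = enorm x ^+ 2 + 2 * dot x y + enorm y ^+ 2.
Proof. by rewrite !sqr_enorm dotDl !dotDr (dotC y x); ring. Qed.

Lemma ler_enormD x y : enorm (x + y) <= enorm x + enorm y.
Proof.
rewrite -ler_sqr ?nnegrE ?addr_ge0 ?enorm_ge0// sqr_enormD; have := dot_le_enorm x y; lra.
Qed.

Lemma ler_dist_enorm x y : `|enorm x - enorm y| <= enorm (x - y).
Proof.
have := ler_enormD (x - y) y; have := ler_enormD (y - x) x.
rewrite !subrK (enormB y x) ler_norml; lra.
Qed.

Lemma cvg_dot (T : Type) (F : set_system T) {FF : Filter F} (f g : T -> 'rV[R]_n) x y :
  f @ F --> x -> g @ F --> y ->
  dot (f t) (g t) @[t --> F] --> dot x y.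
Proof.
move=> fx gy; apply: cvg_big => [|i _]; first exact: add_continuous.
apply: cvgM.
  exact: (cvg_comp _ _ fx (@coord_continuous R 1 n ord0 i x)).
exact: (cvg_comp _ _ gy (@coord_continuous R 1 n ord0 i y)).
Qed.

Lemma enorm_continuous : continuous (@enorm R n).
Proof.
rewrite (_ : @enorm R n = Num.sqrt \o (fun y => dot y y)); last first.
  by apply/funext => y /=; rewrite enormE.
move=> x; apply: continuous_comp; last exact: sqrt_continuous.
exact: (@cvg_dot _ (nbhs x) _ id id x x cvg_id cvg_id).
Qed.

Lemma open_eball0 (r : R) : open (eball0 n r).
Proof.
rewrite (_ : eball0 n r = @enorm R n @^-1` [set s | s < r])//.
by apply: open_comp; [move=> x _; exact: enorm_continuous|exact: open_lt].
Qed.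

Lemma closed_enorm_le (r : R) : closed [set x : 'rV[R]_n | enorm x <= r].
Proof.
rewrite (_ : mkset _ = @enorm R n @^-1` [set s | s <= r])//.
by apply: closed_comp; [move=> x _; exact: enorm_continuous|exact: closed_le].
Qed.

Lemma nbhs_enorm x (e : R) : 0 < e -> \forall y \near x, enorm (y - x) < e.
Proof.
move=> e0; have : (fun y => enorm (y - x)) @ x --> enorm (x - x).
  have yx : (fun y => y - x) @ nbhs x --> x - x.
    by apply: cvgB; [exact: cvg_id|exact: cvg_cst].
  exact: (cvg_comp _ _ yx (enorm_continuous (x - x))).
rewrite subrr enorm0 => /cvgr_lt; exact.
Qed.

(** A point [x] of the closed ball is the limit of [s *: x] as [s] increases to 1, and these points
    lie in the open ball because [0 < r]. *)
Lemma closure_eball0 (r : R) : 0 < r ->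
  closure (eball0 n r) = [set x | enorm x <= r].
Proof.
move=> r0; apply/seteqP; split.
  move=> x; have := @closure_subset _ (eball0 n r) [set y | enorm y <= r].
  rewrite -(proj1 (closure_id _) (closed_enorm_le r)); apply=> y /ltW//.
move=> x xr A /= Ax.
have : \forall s \near (1:R)^'-, A (s *: x).
  apply: cvg_at_left_filter (Ax); rewrite -[X in _ --> X]scale1r.
  by apply: cvgZr_tmp; exact: cvg_id.
move=> As; near (1:R)^'- => s; exists (s *: x); split; last by near: s.
rewrite /eball0/= enormZ ger0_norm; last by near: s; exact: nbhs_left_ge.
have s1 : s < 1 by near: s; exact: nbhs_left_lt.
have s0 : 0 < s by near: s; exact: nbhs_left_gt.
move: xr => /= xr; nra.
Unshelve. all: by end_near.
Qed.

Lemma mx_norm_le_enorm x : `|x| <= enorm x.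
Proof.
rewrite [leLHS]/Num.norm /= mx_normrE; apply/bigmax_leP; split => [|[i j] _ /=].
  exact: enorm_ge0.
by rewrite (ord1 i) enorm_coord.
Qed.

Lemma compact_enorm_le (r : R) : compact [set x : 'rV[R]_n | enorm x <= r].
Proof.
apply: bounded_closed_compact; last exact: closed_enorm_le.
exists r; split; first exact: num_real.
by move=> s rs x /= xr; rewrite (le_trans (mx_norm_le_enorm x))// (le_trans xr)// ltW.
Qed.
End Euclidean.

(** * Quadratic test functions and their gradients *)

Section Quadratic.
Context {R : realType} {n : nat}.
Implicit Types x y q : 'rV[R]_n.

(** The two coefficients serve both variables of a penalty [N |x - t y|^2]: [a = N], [b = 1] for
    tests in [x], and [a = - N], [b = t] for tests in [y]. *)
Definition quad (a b : R) q y : R := a * dot (b *: y - q) (b *: y - q).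

Lemma dot_delta x i : dot x 'e_i = x ord0 i.
Proof.
rewrite /dot (bigD1 i)//= mxE !eqxx mulr1 big1 ?addr0// => j ji.
by rewrite mxE eqxx (negbTE ji) mulr0.
Qed.

Lemma derive_quad a b q y v :
  'D_v (quad a b q) y = 2 * a * b * dot (b *: y - q) v.
Proof.
apply/cvg_lim => //.
(* The difference quotient of a quadratic function is exactly affine in [h]. *)
have lin : (fun h : R => 2 * a * b * dot (b *: y - q) v + h * (a * b ^+ 2 * dot v v))
    @ (0 : R)^' --> 2 * a * b * dot (b *: y - q) v.
  rewrite -[X in _ --> X]addr0; apply: cvgD; first exact: cvg_cst.
  rewrite -[X in _ --> X](mul0r (a * b ^+ 2 * dot v v)); apply: cvgMr_tmp.
  exact: nbhs_dnbhs.
apply: cvg_trans lin; apply: near_eq_cvg; near=> h.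
have h0 : h != 0 by near: h; exact: nbhs_dnbhs_neq.
rewrite /quad /= /shift/= /GRing.scale/=.
rewrite !(dotDl, dotDr, dotZl, dotZr, dotNl, dotNr, scalerDr).
rewrite (dotC q v) (dotC q y) (dotC v y).
by field.
Unshelve. all: by end_near. Qed.

Lemma grad_quad a b q y : grad (quad a b q) y = (2 * a * b) *: (b *: y - q).
Proof. by apply/rowP => i; rewrite [LHS]mxE derive_quad dot_delta [RHS]mxE. Qed.

Lemma differentiable_dot y : differentiable (fun x => dot x x) y.
Proof.
rewrite (_ : (fun x => dot x x) =
  \sum_(i < n) ((fun x : 'rV[R]_n => x ord0 i) * (fun x => x ord0 i))).
  apply: differentiable_sum => i.
  by apply: differentiableM; exact: differentiable_coord.
by apply/funext => x; rewrite fct_sumE.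
Qed.

Lemma differentiable_quad a b q y : differentiable (quad a b q) y.
Proof.
apply: differentiableM; first exact: differentiable_cst.
have := @differentiable_comp R 'rV[R]_n 'rV[R]_n R (fun y => b *: y - q)
  (fun x => dot x x) y; apply; last exact: differentiable_dot.
by apply: differentiableB => //; apply: differentiableZ.
Qed.

Lemma C1_on_quad A a b q : C1_on A (quad a b q).
Proof.
exists setT; split=> [|//|x _]; first exact: openT.
split; first exact: differentiable_quad.
rewrite (_ : grad _ = (fun y => (2 * a * b) *: (b *: y - q))); last first.
  by apply/funext => y; rewrite grad_quad.
have bx : (fun y : 'rV[R]_n => b *: y) @ nbhs x --> b *: x.
  exact: scaler_continuous.
have bxq : (fun y => b *: y - q) @ nbhs x --> b *: x - q.
  by apply: (cvgB bx); exact: cvg_cst.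
exact: (@cvgZl_tmp _ _ _ (nbhs x) _ (2 * a * b) _ _ bxq).
Qed.

End Quadratic.

(** * Viscosity inequalities with quadratic test functions *)

(** With its companion for [snd], this transfers continuity on each factor to the doubled functional
    on a product of sets. *)
Lemma cvg_fst_within (T U : topologicalType) (A : set T) (B : set U) (z : T * U) :
  fst @ within (A `*` B) (nbhs z) --> within A (nbhs z.1).
Proof.
move=> P AP; have : \forall y \near z, A y.1 -> P y.1.
  by case: z AP => a b; exact: (@cvg_fst _ _ (nbhs a) (nbhs b) _ (fun y => A y -> P y)).
by apply: filterS => y AyP [Ay _]; exact: AyP.
Qed.

Lemma cvg_snd_within (T U : topologicalType) (A : set T) (B : set U) (z : T * U) :
  snd @ within (A `*` B) (nbhs z) --> within B (nbhs z.2).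
Proof.
move=> P BP; have : \forall y \near z, B y.2 -> P y.2.
  by case: z BP => a b; exact: (@cvg_snd _ _ (nbhs a) (nbhs b) _ (fun y => B y -> P y)).
by apply: filterS => y ByP [_ By]; exact: ByP.
Qed.

Section Viscosity.
Context {R : realType} {n : nat}.
Implicit Types (x y p q : 'rV[R]_n) (v w : 'rV[R]_n -> R).
Variable H : 'rV[R]_n -> 'rV[R]_n -> R.

Lemma BUC_subset (A B : set 'rV[R]_n) v : A `<=` B -> BUC B v -> BUC A v.
Proof.
move=> AB [[M vM] uc]; split; first by exists M => x /AB; exact: vM.
by move=> e /uc[d d0 vd]; exists d => // x y /AB Bx /AB By; exact: vd.
Qed.

Lemma BUC_continuous (A : set 'rV[R]_n) v : BUC A v -> {within A, continuous v}.
Proof.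
move=> [_ uc]; apply/subspace_continuousP => x Ax.
apply/cvgrPdist_lt => e /uc[d d0 vd]; rewrite near_withinE.
near=> y => Ay; apply: vd => //; rewrite enormB; near: y; exact: nbhs_enorm.
Unshelve. all: by end_near. Qed.

(** Touching is a local condition, so a maximum over a smaller closed ball suffices once [x] is
    interior to it. *)
Lemma subsolution_quad (r r' N : R) v x q :
  viscosity_subsolution H (eball0 n r) v -> r' <= r -> enorm x < r' ->
  (forall y, enorm y <= r' ->
    v y - N * enorm (y - q) ^+ 2 <= v x - N * enorm (x - q) ^+ 2) ->
  v x + H x ((2 * N) *: (x - q)) <= 0.
Proof.
move=> [_ sub] rr xr xmax.
have := sub x (quad N 1 q) (lt_le_trans xr rr) (C1_on_quad _ _ _ _).
rewrite grad_quad mulr1 scale1r; apply.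
rewrite /local_max_over near_withinE; near=> y => _.
rewrite /quad !scale1r -!sqr_enorm; apply/xmax/ltW; near: y.
exact: (open_eball0 r').
Unshelve. all: by end_near. Qed.

(** The point [x] may lie on the sphere: this is where the state constraint enters. The outer factor
    [t] of the gradient comes from the chain rule for the dilation. *)
Lemma supersolution_quad (r N t : R) w x q : 0 < r ->
  viscosity_supersolution H (closure (eball0 n r)) w -> enorm x <= r ->
  (forall y, enorm y <= r ->
    w x + N * enorm (q - t *: x) ^+ 2 <= w y + N * enorm (q - t *: y) ^+ 2) ->
  0 <= w x + H x (t *: ((2 * N) *: (q - t *: x))).
Proof.
move=> r0 [_ sup] xr xmin.
have {sup} := sup x (quad (- N) t q) _ (C1_on_quad _ _ _ _).
rewrite closure_eball0//; move=> /(_ xr).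
rewrite grad_quad (_ : _ *: _ = t *: ((2 * N) *: (q - t *: x))); last first.
  by rewrite -(opprB q) scalerN -scaleNr scalerA; congr (_ *: _); ring.
apply; rewrite /local_min_over near_withinE; near=> y => yr.
rewrite /quad -!sqr_enorm !mulNr !opprK -!(enormB q); exact: xmin.
Unshelve. all: by end_near. Qed.

(** At a minimum point of [w] over the closed ball the zero test function is admissible, which
    bounds the minimum by [- H c 0]. *)
Lemma supersolution_lower_bound (r C : R) w : 0 < r ->
  viscosity_supersolution H (closure (eball0 n r)) w ->
  (forall x, enorm x <= r -> H x 0 <= C) ->
  forall x, enorm x <= r -> - C <= w x.
Proof.
move=> r0 sup HC x xr; have [wBUC _] := sup.
have [|||c] := @compact_EVT_min _ _ w [set x | enorm x <= r].
- by exists x.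
- exact: compact_enorm_le.
- by apply: BUC_continuous; rewrite -closure_eball0.
rewrite inE => /= cr cmin.
have := @supersolution_quad r 0 0 w c 0 r0 sup cr.
rewrite !scale0r => /(_ _)/wrap[y yr|wc].
  by rewrite !mul0r !addr0; apply: cmin; rewrite inE.
have := HC c cr; have := cmin x; rewrite inE => /(_ xr); lra.
Qed.

(** Common core of two doubling arguments: [K] is a closed ball and [gam] a dilation in the
    comparison, [K] is [[0, 1]] and [gam] a segment in the Lipschitz estimate. *)
Lemma penalised_max (r r' m P e : R) v (T : topologicalType) (K : set T)
    (gam : T -> 'rV[R]_n) (g : T -> R) :
  viscosity_subsolution H (eball0 n r) v ->
  (forall x p, enorm x < r -> v x + H x p <= 0 -> enorm p <= P) ->
  compact K -> K !=set0 -> continuous gam -> {within K, continuous g} ->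
  (forall t, K t -> enorm (gam t) <= m) -> m < r' -> r' < r -> 0 < e ->
  exists (N : R) (x : 'rV[R]_n) (t : T), let p := (2 * N) *: (x - gam t) in
    [/\ 0 < N, enorm x < r' /\ K t, enorm (x - gam t) <= e,
        v x + H x p <= 0 /\ enorm p <= P &
        forall y s, enorm y <= r' -> K s ->
          v y - g s - N * enorm (y - gam s) ^+ 2 <=
          v x - g t - N * enorm (x - gam t) ^+ 2].
Proof.
move=> sub vP cK [t0 Kt0] cgam cg gamm mr' r'r e0.
have r'sub : [set x : 'rV[R]_n | enorm x <= r'] `<=` eball0 n r.
  by move=> x /= xr'; exact: le_lt_trans r'r.
have [vBUC _] := sub; have [[M vM] _] := vBUC.
have m0 : 0 <= m := le_trans (enorm_ge0 _) (gamm _ Kt0).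
have M0 : 0 <= M.
  apply: le_trans (vM 0 _) => //; rewrite /eball0/= enorm0; lra.
pose d := r' - m; have d0 : 0 < d by rewrite subr_gt0.
(* The second term makes the penalty at distance [d] exceed the oscillation of [v], which keeps the
   maximizer interior; the third turns the gradient bound [P] into the distance bound [e]. *)
pose N := 1 + 2 * M / d ^+ 2 + `|P| / (2 * e).
have N1 : 0 <= 2 * M / d ^+ 2 by apply: divr_ge0; [rewrite mulr_ge0|exact: sqr_ge0].
have N2 : 0 <= `|P| / (2 * e) by rewrite divr_ge0// mulr_ge0// ltW.
have N0 : 0 < N by rewrite /N; lra.
have Nd : 2 * M < N * d ^+ 2.
  rewrite -ltr_pdivrMr ?exprn_gt0//; rewrite /N; lra.
have Ne : P <= 2 * N * e.
  apply: le_trans (ler_norm _) _.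
  have -> : 2 * N * e = N * (2 * e) by ring.
  by rewrite -ler_pdivrMr ?mulr_gt0// /N; lra.
pose F (z : 'rV[R]_n * T) := v z.1 - g z.2 - N * enorm (z.1 - gam z.2) ^+ 2.
have [|||[x t]] := @compact_EVT_max _ _ F ([set x | enorm x <= r'] `*` K).
- by exists (gam t0, t0); split=> //=; rewrite (le_trans (gamm _ Kt0))// ltW.
- by apply: compact_setX => //; exact: compact_enorm_le.
- apply/subspace_continuousP => z [zr zK].
  apply: cvgB; first apply: cvgB.
  + have /subspace_continuousP/(_ _ zr) := BUC_continuous _ _ (BUC_subset _ _ _ r'sub vBUC).
    exact: (cvg_comp _ _ (cvg_fst_within _ _ _ _ z)).
  + have /subspace_continuousP/(_ _ zK) := cg.
    exact: (cvg_comp _ _ (cvg_snd_within _ _ _ _ z)).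
  + apply: cvg_within_filter.
    have zz : (fun z => z.1 - gam z.2) @ nbhs z --> z.1 - gam z.2.
      case: (z) => a b; apply: (@cvgB _ _ _ _ _ fst (fun z => gam z.2)).
        exact: (@cvg_fst _ _ (nbhs a) (nbhs b)).
      exact: (cvg_comp _ _ (@cvg_snd _ _ (nbhs a) (nbhs b) _) (cgam b)).
    apply: cvgMl_tmp.
    under eq_fun do rewrite sqr_enorm.
    by rewrite sqr_enorm; exact: (@cvg_dot _ _ _ (nbhs z) _ _ _ _ _ zz zz).
rewrite inE => -[/= xr' Kt] xtmax.
have {}xtmax y s : enorm y <= r' -> K s -> F (y, s) <= F (x, t).
  by move=> yr' Ks; apply: xtmax; rewrite inE.
have gt_r' : enorm (gam t) <= r' by rewrite (le_trans (gamm _ Kt))// ltW.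
(* Compare with the pair ([gam t], [t]), where the penalty vanishes and [g] cancels. *)
have Nxt : N * enorm (x - gam t) ^+ 2 <= 2 * M.
  have := xtmax (gam t) t gt_r' Kt; rewrite /F/= subrr enorm0 expr0n/= mulr0.
  have := vM _ (r'sub _ xr'); have := vM _ (r'sub _ gt_r').
  rewrite !ler_norml; lra.
have xd : enorm (x - gam t) < d.
  rewrite -ltr_sqr ?nnegrE ?enorm_ge0 ?(ltW d0)// -(ltr_pM2l N0).
  exact: le_lt_trans Nd.
have xr : enorm x < r'.
  have := ler_enormD (x - gam t) (gam t); rewrite subrK.
  have := gamm _ Kt; rewrite /d in xd; lra.
have px : v x + H x ((2 * N) *: (x - gam t)) <= 0.
  apply: (@subsolution_quad r r') => //; first exact: ltW.
  by move=> y yr'; have := xtmax y t yr' Kt; rewrite /F/=; lra.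
have pP := vP _ _ (lt_trans xr r'r) px.
exists N, x, t; split => //.
rewrite -(ler_pM2l (_ : 0 < 2 * N)) ?mulr_gt0//; apply: le_trans Ne.
by rewrite enormZ gtr0_norm ?mulr_gt0 in pP.
Qed.
End Viscosity.

(** * Comparison and the rate *)

Section Comparison.
Context {R : realType} {n : nat}.
Implicit Types (x y p q : 'rV[R]_n) (v w : 'rV[R]_n -> R).
Variable H : 'rV[R]_n -> 'rV[R]_n -> R.

(** The touching gradients are [p] for [v] and [t *: p] for [w], at distance at most [(1 - t) * P];
    the touching points are at distance at most [1 - t] up to a small error. The Lipschitz bound on
    [H] turns both into multiples of [1 - t]. *)
Lemma dilated_comparison (r s t P C : R) v w :
  viscosity_subsolution H (eball0 n r) v ->
  viscosity_supersolution H (closure (eball0 n s)) w ->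
  (forall x p, enorm x < r -> v x + H x p <= 0 -> enorm p <= P) ->
  0 <= C ->
  (forall x y p q, enorm x <= 1 -> enorm y <= 1 -> enorm p <= P -> enorm q <= P ->
    H y q - H x p <= C * (enorm (y - x) + enorm (q - p))) ->
  r <= 1 -> 0 < s <= 1 -> 0 <= t <= 1 -> t * s < r ->
  forall z, enorm z <= s -> v (t *: z) - w z <= C * (1 + P) * (1 - t).
Proof.
move=> sub sup vP C0 HL r1 /andP[s0 s1] /andP[t0 t1] tsr z zs.
apply/ler_addgt0Pr => e e0.
pose r' := (t * s + r) / 2.
(* The tolerance [e / (C + 1)] contributes at most [e], also when [C = 0]. *)
have [||||||||N [a [b [N0 [ar' bs]]]]] := @penalised_max R n H r r' (t * s) P
  (e / (C + 1)) v 'rV[R]_n [set y | enorm y <= s] (fun y => t *: y) w sub vP.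
- exact: compact_enorm_le.
- by exists z.
- exact: scaler_continuous.
- by apply: BUC_continuous; rewrite -closure_eball0//; case: sup.
- by move=> y /= ys; rewrite enormZ ger0_norm// ler_wpM2l.
- rewrite /r'; lra.
- rewrite /r'; lra.
- by rewrite divr_gt0// ltr_wpDl.
set p := (2 * N) *: _ => /= ab [ap pP] abmax.
have bp : 0 <= w b + H b (t *: p).
  apply: (@supersolution_quad R n H s N t w b a) => // y ys.
  have := abmax a y (ltW ar') ys; lra.
have a1 : enorm a <= 1 by rewrite /r' in ar'; lra.
have tpP : enorm (t *: p) <= P.
  rewrite enormZ ger0_norm//; have := enorm_ge0 p; nra.
have := HL a b p (t *: p) a1 (le_trans bs s1) pP tpP.
have -> : t *: p - p = - ((1 - t) *: p) by rewrite scalerBl scale1r opprB.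
rewrite enormN enormZ ger0_norm ?subr_ge0//.
have ba : enorm (b - a) <= e / (C + 1) + (1 - t).
  have := ler_enormD (t *: b - a) ((1 - t) *: b).
  rewrite (_ : _ + _ = b - a); last first.
    by rewrite scalerBl scale1r addrC addrA subrK.
  rewrite enormZ ger0_norm ?subr_ge0//.
  rewrite (enormB (t *: b)).
  have : (1 - t) * enorm b <= 1 - t.
    by rewrite ler_piMr ?subr_ge0// (le_trans bs).
  lra.
have Ce : C * (e / (C + 1)) <= e.
  rewrite mulrCA ger_pMr// ler_pdivrMr ?ltr_wpDl//; lra.
have tz : enorm (t *: z) <= r'.
  rewrite enormZ ger0_norm// /r'; have := enorm_ge0 z; nra.
(* The pair ([t *: z], [z]) has no penalty and yields the difference to be estimated. *)
have := abmax _ z tz zs; rewrite subrr enorm0 expr0n/= mulr0 subr0.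
have : 0 <= N * enorm (a - t *: b) ^+ 2 by rewrite mulr_ge0 ?exprn_ge0 ?enorm_ge0 ?(ltW N0).
have : (1 - t) * enorm p <= (1 - t) * P by rewrite ler_wpM2l// subr_ge0.
move: ba pP (enorm_ge0 (b - a)) => ba pP ba0 pt Nab vw HH.
have : C * (enorm (b - a) + (1 - t) * enorm p) <=
       C * (e / (C + 1) + (1 - t) + (1 - t) * P) by rewrite ler_wpM2l// lerD.
lra.
Qed.

(* Slide along the segment: maximize [v a - K s |y - x| - N |a - (x + s (y - x))|^2]
   over [a] and [0 <= s <= 1] with [K > P].  At the maximum the derivative in [s] is
   at most [(P - K) |y - x| < 0], so [s = 0] and [a] is close to [x]. *)
Lemma subsolution_lipschitz (r P : R) v :
  viscosity_subsolution H (eball0 n r) v ->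
  (forall x p, enorm x < r -> v x + H x p <= 0 -> enorm p <= P) ->
  forall x y, enorm x < r -> enorm y < r -> v y - v x <= P * enorm (y - x).
Proof.
move=> sub vP x y xr yr; have [[_ uc] _] := sub.
have [->|yx] := eqVneq y x; first by rewrite !subrr enorm0 mulr0.
have l0 : 0 < enorm (y - x).
  rewrite lt_def enorm_ge0 andbT; apply: contra_neq yx => /enorm_eq0/eqP.
  by rewrite subr_eq0 => /eqP.
apply/ler_addgt0Pr => e e0.
(* The excess slope costs [e / 2] over the whole segment; uniform continuity of [v] accounts for the
   other half of [e]. *)
pose K := P + e / 2 / enorm (y - x).
have KP : P < K by rewrite /K ltrDl !divr_gt0.
have Ke : K * enorm (y - x) = P * enorm (y - x) + e / 2.
  by rewrite /K mulrDl divfK ?gt_eqF.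
have [d d0 vd] := uc (e / 2) (divr_gt0 e0 (ltr0n _ 2)).
pose m := Num.max (enorm x) (enorm y).
have mr : m < r by rewrite /m gt_max xr.
pose r' := (m + r) / 2.
have d2 : 0 < d / 2 by rewrite divr_gt0.
have [||||||||N [a [s [N0 [ar' s01]]]]] := @penalised_max R n H r r' m P
  (d / 2) v R [set s | s \in `[0, 1]] (fun s => x + s *: (y - x))
  (fun s => K * s * enorm (y - x)) sub vP.
- exact: segment_compact.
- by exists 0; rewrite /= in_itv/= lexx ler01.
- move=> s; apply: cvgD; first exact: cvg_cst.
  exact: (@cvgZr_tmp _ _ _ (nbhs s) _ id _ _ cvg_id).
- apply: continuous_subspaceT => s.
  apply: (@cvgMr_tmp _ _ (nbhs s) _ (fun s => K * s)).
  exact: (@cvgMl_tmp _ _ (nbhs s) _ id K s cvg_id).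
- move=> s /=; rewrite in_itv/= => /andP[s0 s1].
  have -> : x + s *: (y - x) = (1 - s) *: x + s *: y.
    by rewrite scalerBr scalerBl scale1r addrCA addrC.
  apply: le_trans (ler_enormD _ _) _.
  rewrite !enormZ !ger0_norm ?subr_ge0//.
  have xm : enorm x <= m by rewrite /m le_max lexx.
  have ym : enorm y <= m by rewrite /m le_max lexx orbT.
  nra.
- rewrite /r'; lra.
- rewrite /r'; lra.
- by [].
set p := (2 * N) *: _ => ad [_ pP] amax.
move: s01; rewrite /= in_itv/= => /andP[s0 s1].
have {}s0 : s = 0.
  apply/eqP; rewrite eq_le s0 andbT leNgt; apply/negP => s_gt0.
  pose l := enorm (y - x).
  have Nl : 0 < 2 * N * l by rewrite !mulr_gt0.
  (* A step back by [h] stays in [[0, 1]], and its second-order penalty term uses at most half of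
     the first-order gain [(K - P) * l]. *)
  pose h := Num.min s ((K - P) / (2 * N * l)).
  have h0 : 0 < h by rewrite /h lt_min s_gt0 divr_gt0 ?subr_gt0.
  have hs : h <= s by rewrite /h ge_min lexx.
  have hK : h * (2 * N * l) <= K - P.
    by rewrite -ler_pdivlMr// /h ge_min lexx orbT.
  have := amax a (s - h) (ltW ar').
  rewrite /= in_itv/= subr_ge0 hs (le_trans _ s1) ?gerBl ?(ltW h0)// => /(_ isT).
  pose q := a - (x + s *: (y - x)).
  have -> : a - (x + (s - h) *: (y - x)) = q + h *: (y - x).
    by rewrite /q scalerBl !opprD !opprK !addrA.
  rewrite -/q sqr_enormD dotZr enormZ gtr0_norm// -/l => le1.
  have : dot p (y - x) <= P * l.
    by apply: le_trans (dot_le_enorm _ _) _; rewrite ler_wpM2r// ltW.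
  rewrite /p -/q dotZl => pl.
  have : h * (K * l) <= h * (P * l + h * N * l ^+ 2).
    have : h * (2 * N * dot q (y - x)) <= h * (P * l) by rewrite ler_wpM2l// ltW.
    lra.
  rewrite ler_pM2l// => le2.
  have : K <= P + h * N * l by rewrite -(ler_pM2r (l0 : 0 < l)); lra.
  lra.
have x0 : x + s *: (y - x) = x by rewrite s0 scale0r addr0.
(* At the far end of the segment, [y] itself is a competitor without penalty. *)
have := amax y 1; rewrite /= in_itv/= ler01 lexx scale1r.
rewrite (_ : x + (y - x) = y); last by rewrite addrC subrK.
rewrite subrr enorm0 expr0n/= mulr0 mulr1 subr0 x0 s0 mulr0 mul0r subr0.
have yr' : enorm y <= r'.
  have : enorm y <= m by rewrite /m le_max lexx orbT.
  rewrite /r'; lra.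
have Na : 0 <= N * enorm (a - x) ^+ 2 by rewrite mulr_ge0 ?exprn_ge0 ?enorm_ge0 ?(ltW N0).
move=> /(_ yr' isT).
have := vd a x; rewrite /eball0/=.
have ar : enorm a < r by rewrite /r' in ar'; lra.
have {}ad : enorm (a - x) < d by rewrite x0 in ad; lra.
move=> /(_ ar xr ad); rewrite ltr_norml => /andP[_]; lra.
Qed.
End Comparison.

(** * Constants depending only on the Hamiltonian, and the rate *)

Section Rate.
Context {R : realType} {n : nat}.
Implicit Types (x y p q : 'rV[R]_n) (u v w : 'rV[R]_n -> R).

(** [P] is a radius beyond which coercivity gives [H >= C0 + 1]. [C] is the local Lipschitz constant
    at radius [P], made nonnegative by a maximum with 0. *)
Lemma hamiltonian_bounds (H : 'rV[R]_n -> 'rV[R]_n -> R) :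
  hamiltonian_assumptions (eball0 n 1) H ->
  exists C0 P C : R, [/\ 0 < P, 0 <= C,
    forall x, enorm x <= 1 -> H x 0 <= C0,
    forall x p, enorm x <= 1 -> H x p <= C0 -> enorm p <= P &
    forall x y p q, enorm x <= 1 -> enorm y <= 1 -> enorm p <= P -> enorm q <= P ->
      H y q - H x p <= C * (enorm (y - x) + enorm (q - p))].
Proof.
case=> _ _ [C0 C0_gt0 H0] Hlip Hcoer.
have ball1 : closure (eball0 n 1) = [set x : 'rV[R]_n | enorm x <= 1].
  exact: closure_eball0.
have [P P0 HP] : exists2 P : R, 0 < P & forall p : 'rV[R]_n, P <= enorm p ->
    ((C0 + 1)%:E <= ereal_inf [set (H x p)%:E | x in closure (eball0 n 1)])%E.
  near (pinfty_nbhs R) => P; exists P; near: P; last exact: Hcoer.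
  exact: nbhs_pinfty_gt.
have [C HC] := Hlip P P0.
exists C0, P, (Num.max C 0); split => //.
- by rewrite le_max lexx orbT.
- move=> x x1; apply: le_trans (ler_norm _) _; rewrite -lee_fin.
  by apply: le_trans H0; apply: ereal_sup_ubound; exists x; rewrite ?ball1.
- move=> x p x1 Hxp; rewrite leNgt; apply/negP => /ltW/HP.
  apply/negP; rewrite -ltNge; apply: (@le_lt_trans _ _ (H x p)%:E).
    by apply: ereal_inf_lbound; exists x; rewrite ?ball1.
  by rewrite lte_fin; lra.
- move=> x y p q x1 y1 pP qP.
  have := HC y x q q; rewrite !ball1 => /(_ y1 x1 qP qP)[h1 _].
  have := HC x x q p; rewrite !ball1 => /(_ x1 x1 qP pP)[_ h2].
  have CC : C <= Num.max C 0 by rewrite le_max lexx.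
  have h3 : C * enorm (y - x) <= Num.max C 0 * enorm (y - x).
    by rewrite ler_wpM2r ?enorm_ge0.
  have h4 : C * enorm (q - p) <= Num.max C 0 * enorm (q - p).
    by rewrite ler_wpM2r ?enorm_ge0.
  move: h1 h2; rewrite !ler_norml; lra.
Unshelve. all: by end_near. Qed.

(** Carries the upper bound to the sphere, since the Lipschitz estimate for subsolutions reaches
    interior points only. *)
Lemma BUC_le_closed_ball (r c : R) u v : 0 < r ->
  BUC [set x | enorm x <= r] u -> BUC [set x | enorm x <= r] v ->
  (forall x, enorm x < r -> u x - v x <= c) ->
  forall x, enorm x <= r -> u x - v x <= c.
Proof.
move=> r0 [_ ucu] [_ ucv] uvc x xr; apply/ler_addgt0Pr => e e0.
have e2 : 0 < e / 2 by rewrite divr_gt0.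
have [d d0 ud] := ucu _ e2; have [d' d'0 vd] := ucv _ e2.
have : closure (eball0 n r) x by rewrite closure_eball0.
move=> /(_ [set y | enorm (y - x) < Num.min d d'])[|y [/= yr]].
  by apply: nbhs_enorm; rewrite lt_min d0.
rewrite lt_min => /andP[yd yd'].
have := ud y x (ltW yr) xr yd; have := vd y x (ltW yr) xr yd'.
rewrite !ltr_norml; have := uvc y yr; lra.
Qed.

Lemma state_constraint_rate (H : 'rV[R]_n -> 'rV[R]_n -> R) :
  hamiltonian_assumptions (eball0 n 1) H ->
  exists C : R, forall (r : R) (v u : 'rV[R]_n -> R), 0 < r < 1 ->
    state_constraint_solution H (eball0 n r) v ->
    state_constraint_solution H (eball0 n 1) u ->
    forall x, enorm x <= r -> 0 <= v x - u x <= C * (1 - r).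
Proof.
move=> /hamiltonian_bounds[C0 [P [C [P0 C_ge0 HC0 HP HC]]]].
(* The first summand is the cost of the dilated comparison, the second the Lipschitz cost of moving
   from [t *: x] to [x]. *)
exists (C * (1 + P) + P) => r v u /andP[r0 r1] [vsub vsup] [usub usup] x xr.
(* From [w >= - C0], the inequality [w x + H x p <= 0] forces [H x p <= C0], hence the bound on
   [p]. *)
have grad_bound s w : 0 < s <= 1 -> viscosity_supersolution H (closure (eball0 n s)) w ->
    forall x p, enorm x < s -> w x + H x p <= 0 -> enorm p <= P.
  move=> /andP[s0 s1] wsup y p ys wp; apply: (HP y); first exact: le_trans (ltW ys) s1.
  have := @supersolution_lower_bound R n H s C0 w s0 wsup _ y (ltW ys).
  move=> /(_ _)/wrap[z zs|]; first by apply: HC0; exact: le_trans zs s1.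
  lra.
have vP := grad_bound r v _ vsup; have uP := grad_bound 1 u _ usup.
rewrite r0 ltW// in vP; rewrite ltr01 lexx in uP.
have {}vP := vP isT; have {}uP := uP isT.
have vBUC : BUC [set x | enorm x <= r] v by rewrite -closure_eball0//; case: vsup.
have uBUC : BUC [set x | enorm x <= r] u.
  have [uBUC _] := usup; apply: BUC_subset uBUC.
  by rewrite closure_eball0// => y /= yr; exact: le_trans (ltW r1).
apply/andP; split.
  have := @dilated_comparison R n H 1 r 1 P C u v usub vsup uP C_ge0 HC.
  rewrite lexx r0 (ltW r1) ler01 mul1r r1 => /(_ isT isT isT isT x xr).
  by rewrite scale1r subrr mulr0; lra.
apply: (@BUC_le_closed_ball r) => // {xr}x xr.
(* The dilation must map the closed unit ball strictly inside the ball of radius [r], so [t = r] is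
   reached only in the limit. *)
have sharp t : 0 < t < r -> v x - u x <= (C * (1 + P) + P) * (1 - t).
  move=> /andP[t0 tr].
  have := @dilated_comparison R n H r 1 t P C v u vsub usup vP C_ge0 HC.
  rewrite lexx ltr01 mulr1 tr (ltW r1) (ltW t0) (ltW (lt_trans tr r1)).
  move=> /(_ isT isT isT isT x (ltW (lt_trans xr r1))) vu.
  have txr : enorm (t *: x) < r.
    by rewrite enormZ gtr0_norm//; have := enorm_ge0 x; nra.
  have := @subsolution_lipschitz R n H r P v vsub vP (t *: x) x txr xr.
  rewrite (_ : x - t *: x = (1 - t) *: x); last by rewrite scalerBl scale1r.
  rewrite enormZ ger0_norm; last lra.
  have : (1 - t) * enorm x <= 1 - t by rewrite ler_piMr ?subr_ge0; lra.
  nra.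
apply/ler_addgt0Pr => e e0.
pose D := C * (1 + P) + P.
have D0 : 0 < D by rewrite ltr_wpDl// mulr_ge0// addr_ge0// ltW.
(* Use [t = r - d]: the first bound keeps [t] positive, the second limits the loss [D * d] to
   [e]. *)
pose d := Num.min (r / 2) (e / D).
have d0 : 0 < d by rewrite lt_min !divr_gt0.
have dr : d <= r / 2 by rewrite /d ge_min lexx.
have dD : d * D <= e by rewrite -ler_pdivlMr// /d ge_min lexx orbT.
have := sharp (r - d); rewrite -/D; lra.
Qed.
End Rate.

(** * Optimality *)

(** Fermat's rule: a difference quotient at a small positive [h] excludes a positive derivative, one
    at a small negative [h] a negative derivative. *)
Lemma derive_local_max (R : realType) (V : normedModType R) (f : V -> R) (x w : V) :
  derivable f x w -> (\forall y \near x, f y <= f x) -> 'D_w f x = 0.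
Proof.
move=> fx fmax; set l := 'D_w f x.
have lP : h^-1 *: (f (h *: w + x) - f x) @[h --> (0 : R)^'] --> l := fx.
have fmax0 : \forall h \near (0 : R)^', f (h *: w + x) <= f x.
  apply: nbhs_dnbhs; have hx : (fun h : R => h *: w + x) @ nbhs (0 : R) --> 0 *: w + x.
    have hw : (fun h : R => h *: w) @ nbhs (0 : R) --> 0 *: w.
      exact: (@cvgZr_tmp _ _ _ (nbhs (0 : R)) _ id 0 w cvg_id).
    by apply: (cvgD hw); exact: cvg_cst.
  rewrite scale0r add0r in hx.
  exact: (hx _ fmax).
apply/eqP; rewrite eq_le; apply/andP; split; rewrite leNgt; apply/negP => l0.
  have : \forall h \near (0 : R)^', 0 < h^-1 *: (f (h *: w + x) - f x).
    exact: (cvgr_gt _ lP).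
  move=> /(filterI fmax0) [e /= e0 /(_ (e / 2))/=].
  rewrite sub0r normrN gtr0_norm ?divr_gt0//.
  rewrite ltr_pdivrMr// ltr_pMr// ltr1n gt_eqF ?divr_gt0//.
  move=> /(_ isT isT)[fe]; rewrite /GRing.scale/= pmulr_rgt0 ?invr_gt0 ?divr_gt0//.
  by rewrite subr_gt0 ltNge fe.
have : \forall h \near (0 : R)^', h^-1 *: (f (h *: w + x) - f x) < 0.
  exact: (cvgr_lt _ lP).
move=> /(filterI fmax0) [e /= e0 /(_ (- (e / 2)))/=].
rewrite sub0r opprK gtr0_norm ?divr_gt0//.
rewrite ltr_pdivrMr// ltr_pMr// ltr1n oppr_eq0 gt_eqF ?divr_gt0//.
move=> /(_ isT isT)[fe]; rewrite /GRing.scale/= nmulr_rlt0 ?invr_lt0 ?oppr_lt0 ?divr_gt0//.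
by rewrite subr_gt0 ltNge fe.
Qed.

Lemma derive_local_min (R : realType) (V : normedModType R) (f : V -> R) (x w : V) :
  derivable f x w -> (\forall y \near x, f x <= f y) -> 'D_w f x = 0.
Proof.
move=> fx fmin; apply/eqP; rewrite -oppr_eq0 -deriveN//; apply/eqP.
apply: derive_local_max; first exact: derivableN.
by apply: filterS fmin => y; rewrite lerN2.
Qed.

(** Reduces Lipschitz bounds for the extremal Hamiltonian to its three branches. *)
Lemma normr_max_sub_le (R : realDomainType) (a b c d e : R) :
  `|a - c| <= e -> `|b - d| <= e -> `|Num.max a b - Num.max c d| <= e.
Proof.
by rewrite !ler_norml; case: (leP a b) => ?; case: (leP c d) => ?; lra.
Qed.

(** * A Hamiltonian for which the rate is attained *)

Section Example.
Context {R : realType} {n : nat}.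
Implicit Types (x y p q : 'rV[R]_n) (u v w : 'rV[R]_n -> R).

(* The cost is [0] while moving with velocity [x / 2] and [- |x|^4] while standing
   still, so the optimal paths go to the boundary and stop there; the term
   [enorm p - 2] gives coercivity and is inactive on the solutions. *)
Definition extremal_hamiltonian x p : R :=
  Num.max (- dot x p / 2) (Num.max (enorm x ^+ 4) (enorm p - 2)).

(** Moving with velocity [x / 2], the path reaches the sphere with discount factor [|x|^2 / r^2];
    resting there is worth [- r^4]. The product is the value function. *)
Definition extremal_solution (r : R) : 'rV[R]_n -> R := quad (- r ^+ 2) 1 0.

Lemma extremal_solutionE r x : extremal_solution r x = - r ^+ 2 * enorm x ^+ 2.
Proof. by rewrite /extremal_solution /quad scale1r subr0 sqr_enorm. Qed.

Lemma grad_extremal_solution r x :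
  grad (extremal_solution r) x = (- 2 * r ^+ 2) *: x.
Proof. by rewrite grad_quad scale1r subr0; congr (_ *: _); ring. Qed.

Lemma extremal_hamiltonian_ge_pow4 x p : enorm x ^+ 4 <= extremal_hamiltonian x p.
Proof. by rewrite /extremal_hamiltonian !le_max lexx orbT. Qed.

Lemma extremal_hamiltonian_ge_linear x p : enorm p - 2 <= extremal_hamiltonian x p.
Proof. by rewrite /extremal_hamiltonian !le_max lexx !orbT. Qed.

(** The first branch equals [r^2 |x|^2]. It dominates [|x|^4] because [|x| <= r], and the third
    branch is nonpositive because the gradient has norm [2 r^2 |x| <= 2]. *)
Lemma extremal_equation (r : R) x : 0 < r <= 1 -> enorm x <= r ->
  extremal_solution r x + extremal_hamiltonian x ((- 2 * r ^+ 2) *: x) = 0.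
Proof.
move=> /andP[r0 r1] xr; have x0 := enorm_ge0 x.
rewrite extremal_solutionE /extremal_hamiltonian dotZr -sqr_enorm enormZ.
have -> : - (- 2 * r ^+ 2 * enorm x ^+ 2) / 2 = r ^+ 2 * enorm x ^+ 2 by field.
have r2 : 0 <= r ^+ 2 <= 1 by rewrite exprn_ge0 ?exprn_ile1 ?(ltW r0).
have xr2 : enorm x ^+ 2 <= r ^+ 2 by rewrite ler_sqr ?nnegrE ?(ltW r0).
rewrite max_l; first by ring.
rewrite mulNr normrN ger0_norm; last by lra.
rewrite ge_max; apply/andP; split.
  by rewrite (exprM _ 2 2) expr2 ler_wpM2r ?exprn_ge0.
have : r ^+ 2 * enorm x <= 1 by rewrite mulr_ile1 ?exprn_ge0 //; lra.
have : 0 <= r ^+ 2 * enorm x ^+ 2 by rewrite mulr_ge0 ?exprn_ge0// ltW.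
lra.
Qed.

Lemma extremal_hamiltonian_admissible :
  hamiltonian_assumptions (eball0 n 1) extremal_hamiltonian.
Proof.
have ball1 : closure (eball0 n 1) = [set x : 'rV[R]_n | enorm x <= 1].
  exact: closure_eball0.
have H0 x p : 0 <= extremal_hamiltonian x p.
  by apply: le_trans (extremal_hamiltonian_ge_pow4 x p); rewrite exprn_ge0 ?enorm_ge0.
split.
- apply: continuous_subspaceT => z.
  have c1 : (fun z : 'rV[R]_n * 'rV[R]_n => z.1) @ nbhs z --> z.1.
    by case: (z) => a b; exact: (@cvg_fst _ _ (nbhs a) (nbhs b)).
  have c2 : (fun z : 'rV[R]_n * 'rV[R]_n => z.2) @ nbhs z --> z.2.
    by case: (z) => a b; exact: (@cvg_snd _ _ (nbhs a) (nbhs b)).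
  have m1 : {for z, continuous (fun z : 'rV[R]_n * 'rV[R]_n => - dot z.1 z.2 / 2 : R^o)}.
    apply: cvgMr_tmp; apply: cvgN.
    exact: (@cvg_dot _ _ _ (nbhs z) _ _ _ _ _ c1 c2).
  have m2 : {for z, continuous (fun z : 'rV[R]_n * 'rV[R]_n => enorm z.1 ^+ 4 : R^o)}.
    exact: (cvg_comp _ _ (cvg_comp _ _ c1 (enorm_continuous z.1))
      (@exprn_continuous R 4 (enorm z.1))).
  have m3 : {for z, continuous (fun z : 'rV[R]_n * 'rV[R]_n => enorm z.2 - 2 : R^o)}.
    by apply: (cvgB (cvg_comp _ _ c2 (enorm_continuous z.2))); exact: cvg_cst.
  exact: (continuous_max m1 (continuous_max m2 m3)).
- by exists 1 => // x p _; apply: le_trans (H0 x p); rewrite lerN10.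
- exists 1 => //; apply: ge_ereal_sup => _ [x + <-]; rewrite ball1 /= => x1.
  rewrite lee_fin ger0_norm// /extremal_hamiltonian dot0r enorm0 oppr0 mul0r.
  rewrite !ge_max ler01 exprn_ile1 ?enorm_ge0//=; lra.
(* In [x] the branches have Lipschitz constants [r / 2], 4 and 0, in [p] they have [1 / 2], 0 and 1;
   [r + 4] exceeds all of them. *)
- move=> r r0; exists (r + 4) => x y p q; rewrite !ball1/= => x1 y1 pr qr; split.
    have xy0 := enorm_ge0 (x - y).
    apply: normr_max_sub_le.
      have -> : - dot x p / 2 - - dot y p / 2 = - dot (x - y) p / 2.
        by rewrite dotDl dotNl; field.
      rewrite normrM normrN (gtr0_norm (_ : 0 < 2^-1)) ?invr_gt0//.
      have := normr_dot_le (x - y) p; nra.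
    apply: normr_max_sub_le; last by rewrite subrr normr0 mulr_ge0//; lra.
    have -> : enorm x ^+ 4 - enorm y ^+ 4 =
      (enorm x - enorm y) * ((enorm x + enorm y) * (enorm x ^+ 2 + enorm y ^+ 2)) by ring.
    rewrite normrM.
    have x0 := enorm_ge0 x; have y0 := enorm_ge0 y.
    have x2 : 0 <= enorm x ^+ 2 <= 1 by rewrite exprn_ge0// exprn_ile1.
    have y2 : 0 <= enorm y ^+ 2 <= 1 by rewrite exprn_ge0// exprn_ile1.
    rewrite mulrC; apply: ler_pM => //; last exact: ler_dist_enorm.
    rewrite ger0_norm; last by rewrite mulr_ge0 ?addr_ge0 ?exprn_ge0.
    have : (enorm x + enorm y) * (enorm x ^+ 2 + enorm y ^+ 2) <= 2 * 2.
      by apply: ler_pM; lra.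
    lra.
  have pq0 := enorm_ge0 (p - q).
  apply: normr_max_sub_le.
    have -> : - dot x p / 2 - - dot x q / 2 = - dot x (p - q) / 2.
      by rewrite dotDr dotNr; field.
    rewrite normrM normrN (gtr0_norm (_ : 0 < 2^-1)) ?invr_gt0//.
    have := normr_dot_le x (p - q); nra.
  apply: normr_max_sub_le; first by rewrite subrr normr0 mulr_ge0//; lra.
  have -> : enorm p - 2 - (enorm q - 2) = enorm p - enorm q by ring.
  have := ler_dist_enorm p q; nra.
- move=> M; exists (M + 2); split; first exact: num_real.
  move=> s Ms p sp; apply: le_ereal_inf_tmp => _ [x _ <-]; rewrite lee_fin.
  apply: le_trans (extremal_hamiltonian_ge_linear x p); lra.
Qed.

Lemma BUC_extremal_solution (r : R) A : 0 < r <= 1 ->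
  A `<=` [set x | enorm x <= r] -> BUC A (extremal_solution r).
Proof.
move=> /andP[r0 r1] Ar; split.
  exists 1 => x /Ar /= xr; rewrite extremal_solutionE mulNr normrN ger0_norm.
    by rewrite mulr_ile1 ?exprn_ge0 ?exprn_ile1 ?enorm_ge0 ?(ltW r0)// (le_trans xr).
  by rewrite mulr_ge0 ?exprn_ge0 ?enorm_ge0 ?(ltW r0).
move=> e e0; exists (e / 2); first by rewrite divr_gt0.
move=> x y /Ar /= xr /Ar /= yr xy; rewrite !extremal_solutionE.
have -> : - r ^+ 2 * enorm x ^+ 2 - - r ^+ 2 * enorm y ^+ 2 =
  (enorm x - enorm y) * (- r ^+ 2 * (enorm x + enorm y)) by ring.
rewrite normrM mulNr normrN (ger0_norm (_ : 0 <= r ^+ 2 * _)); last first.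
  by rewrite mulr_ge0 ?addr_ge0 ?exprn_ge0 ?enorm_ge0 ?(ltW r0).
have x0 := enorm_ge0 x; have y0 := enorm_ge0 y.
have r2 : 0 <= r ^+ 2 <= 1 by rewrite exprn_ge0 ?exprn_ile1 ?(ltW r0).
have : r ^+ 2 * (enorm x + enorm y) <= 1 * 2 by apply: ler_pM; lra.
have := ler_dist_enorm x y; have := normr_ge0 (enorm x - enorm y).
nra.
Qed.

(** The candidate is smooth, so at an interior touching point the test function has the same
    gradient and the equation holds with equality. *)
Lemma extremal_solutionP (r : R) : 0 < r <= 1 ->
  state_constraint_solution extremal_hamiltonian (eball0 n r) (extremal_solution r).
Proof.
move=> r01; have /andP[r0 r1] := r01.
have der x phi (i : 'I_n) : differentiable phi x ->
    derivable (fun y => extremal_solution r y - phi y) x 'e_i /\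
    'D_('e_i) (fun y => extremal_solution r y - phi y) x =
    grad (extremal_solution r) x ord0 i - grad phi x ord0 i.
  move=> dphi; have d1 := diff_derivable (differentiable_quad (- r ^+ 2) 1 0 x).
  have d2 := diff_derivable dphi.
  split; first exact: derivableB.
  by rewrite !mxE; apply: deriveB.
split; split.
- by apply: BUC_extremal_solution => // x /ltW.
- move=> x phi xr [V [_ rV Vphi]] xmax.
  have dphi := (Vphi x (rV x xr)).1.
  rewrite (_ : grad phi x = (- 2 * r ^+ 2) *: x).
    by rewrite extremal_equation// ltW.
  rewrite -grad_extremal_solution; apply/rowP => i; apply/esym/eqP.
  have [di Di] := der x phi i dphi; rewrite -subr_eq0 -Di; apply/eqP.
  apply: derive_local_max => //; move: xmax; rewrite /local_max_over near_withinE.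
  by apply: filterS2 (open_eball0 r x xr) => y yr; exact.
- by rewrite closure_eball0//; apply: BUC_extremal_solution.
- rewrite closure_eball0// => x phi xr [V [_ rV Vphi]] xmin.
  have dphi := (Vphi x (rV x xr)).1.
  move: xr => /=; rewrite le_eqVlt => /orP[/eqP xr|xr].
    (* On the sphere the value is [- r^4], and the branch [|x|^4 = r^4] compensates it for every
       gradient. *)
    have := extremal_hamiltonian_ge_pow4 x (grad phi x).
    rewrite extremal_solutionE xr; lra.
  rewrite (_ : grad phi x = (- 2 * r ^+ 2) *: x).
    by rewrite extremal_equation// ltW.
  rewrite -grad_extremal_solution; apply/rowP => i; apply/esym/eqP.
  have [di Di] := der x phi i dphi; rewrite -subr_eq0 -Di; apply/eqP.
  apply: derive_local_min => //; move: xmin; rewrite /local_min_over near_withinE.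
  by apply: filterS2 (open_eball0 r x xr) => y yr; apply; exact: ltW.
Qed.

(** On the sphere of radius [r] the gap is [r^2 (1 + r) (1 - r)], and [r >= 1 / 2] bounds the first
    two factors below by [3 / 8]. A positive dimension supplies a unit vector. *)
Lemma extremal_gap (r : R) : (0 < n)%N -> 1 / 2 <= r < 1 ->
  exists2 x : 'rV[R]_n, enorm x <= r &
    1 / 4 * (1 - r) <= extremal_solution r x - extremal_solution 1 x.
Proof.
move=> n0 /andP[r0 r1]; pose e : 'rV[R]_n := 'e_(Ordinal n0).
have er : enorm (r *: e) = r.
  rewrite enormZ ger0_norm; last lra.
  by rewrite enormE dot_delta mxE !eqxx sqrtr1 mulr1.
exists (r *: e); first by rewrite er.
rewrite !extremal_solutionE er.
have -> : - r ^+ 2 * r ^+ 2 - - 1 ^+ 2 * r ^+ 2 = r ^+ 2 * (1 + r) * (1 - r) by ring.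
by rewrite ler_wpM2r; nra.
Qed.
End Example.

(* Optimality of the rate: in every dimension some admissible H has
   max (u_k - u) bounded below by a positive multiple of 1/k. *)
Theorem theorem1p5 (R : realType) (n : nat) (n_gt0 : (0 < n)%N) :
  (forall H : 'rV[R]_n -> 'rV[R]_n -> R,
     hamiltonian_assumptions (eball0 n 1) H ->
     exists C : R, forall k : nat, (2 <= k)%N ->
       forall u_k u : 'rV[R]_n -> R,
         state_constraint_solution H (eball0 n (1 - k%:R^-1)) u_k ->
         state_constraint_solution H (eball0 n 1) u ->
         forall x, closure (eball0 n (1 - k%:R^-1)) x ->
           0 <= u_k x - u x <= C / k%:R)
  /\
  (exists H : 'rV[R]_n -> 'rV[R]_n -> R,
     hamiltonian_assumptions (eball0 n 1) H /\
     exists (u : 'rV[R]_n -> R) (u_ : nat -> 'rV[R]_n -> R) (c : R),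
       [/\ 0 < c,
           state_constraint_solution H (eball0 n 1) u &
           forall k : nat, (2 <= k)%N ->
             state_constraint_solution H (eball0 n (1 - k%:R^-1)) (u_ k) /\
             exists2 x, closure (eball0 n (1 - k%:R^-1)) x &
               c / k%:R <= u_ k x - u x]).
Proof.
(* For [k >= 2] the radius [1 - 1/k] lies in [[1/2, 1)], the range that both halves require. *)
have inv_k (k : nat) : (2 <= k)%N -> 0 < (k%:R^-1 : R) <= 1 / 2.
  move=> k2; rewrite invr_gt0 ltr0n (leq_trans _ k2)//= div1r.
  by rewrite lef_pV2 ?posrE ?ltr0n ?(leq_trans _ k2)// ler_nat.
split.
  move=> H /state_constraint_rate[C HC]; exists C => k /inv_k/andP[k0 k2] v u vsol usol x.
  rewrite closure_eball0; last lra.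
  move=> /(HC _ _ _ _ vsol usol); rewrite subKr; apply; lra.
exists extremal_hamiltonian; split; first exact: extremal_hamiltonian_admissible.
exists (extremal_solution 1), (fun k => extremal_solution (1 - k%:R^-1)), (1 / 4).
split; [lra|by apply: extremal_solutionP; rewrite ltr01 lexx|move=> k /inv_k/andP[k0 k2]].
split; first by apply: extremal_solutionP; lra.
have [|x xr gap] := @extremal_gap R n (1 - k%:R^-1) n_gt0; first lra.
exists x; first by rewrite closure_eball0//; lra.
by rewrite subKr in gap.
Qed.
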